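(* Every factorization of $\Delta^2$ into powers of positive half-twists in the braid group $B_3$ has at least three factors.
   Context: $B_3=\langle\sigma_1,\sigma_2:\sigma_1\sigma_2\sigma_1=\sigma_2\sigma_1\sigma_2\rangle$ and $\Delta=\sigma_1\sigma_2\sigma_1$. A positive half-twist is a conjugate of $\sigma_1$ in $B_3$; a power of a positive half-twist means an $e$th power with $e\ge1$ a positive integer, i.e. a conjugate of $\sigma_1^e$. A factorization of $g$ is a tuple $(g_1,\dots,g_k)$ of elements of $B_3$ with $g=g_1\cdots g_k$; $k$ is its number of factors. *)

(* Defs.v *)
From HB Require Import structures.
From mathcomp Require Import all_boot generic_quotient.
From mathcomp Require Import boolp.

Set Implicit Arguments.
Unset Strict Implicit.
Unset Printing Implicit Defensive.

Local Open Scope quotient_scope.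

(* A letter (x, false) stands for the generator x, and (x, true) for its      *)
(* inverse.                                                                   *)
Notation word X := (seq (X * bool)).

Definition winv (X : Type) (w : word X) : word X :=
  rev [seq (a.1, ~~ a.2) | a <- w].

Inductive presentation_eq (X : eqType) (rels : seq (word X * word X)) :
  word X -> word X -> Prop :=
| presentation_refl u : presentation_eq rels u u
| presentation_sym u v : presentation_eq rels u v -> presentation_eq rels v u
| presentation_trans u v w : presentation_eq rels u v ->
    presentation_eq rels v w -> presentation_eq rels u w
| presentation_cat u u' v v' : presentation_eq rels u u' ->
    presentation_eq rels v v' -> presentation_eq rels (u ++ v) (u' ++ v')
| presentation_cancel x b : presentation_eq rels [:: (x, b); (x, ~~ b)] [::]
| presentation_rel r : r \in rels -> presentation_eq rels r.1 r.2.

Section PresentedGroup.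

Variables (X : choiceType) (rels : seq (word X * word X)).

Local Notation peq := (presentation_eq rels).

Definition presentation_eqb (u v : word X) : bool := `[< peq u v >].

Lemma presentation_eqb_refl : reflexive presentation_eqb.
Proof. by move=> u; apply/asboolP; apply: presentation_refl. Qed.

Lemma presentation_eqb_sym : symmetric presentation_eqb.
Proof. by move=> u v; apply/asboolP/asboolP => /presentation_sym. Qed.

Lemma presentation_eqb_trans : transitive presentation_eqb.
Proof.
move=> v u w /asboolP uv /asboolP vw; apply/asboolP.
exact: presentation_trans uv vw.
Qed.

Canonical presentation_equiv :=
  EquivRel presentation_eqb presentation_eqb_refl presentation_eqb_sym
           presentation_eqb_trans.

Definition presented_group := {eq_quot presentation_eqb}.

HB.instance Definition _ := Choice.on presented_group.
HB.instance Definition _ := EqQuotient.on presented_group.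

Definition of_word (w : word X) : presented_group := \pi_presented_group w.

Lemma of_wordP u v : of_word u = of_word v <-> peq u v.
Proof. by split=> [/eqmodP/asboolP | uv]; last exact/eqmodP/asboolP. Qed.

Lemma of_word_repr (g : presented_group) : of_word (repr g) = g.
Proof. exact: reprK. Qed.

Definition presented_mul (g h : presented_group) := of_word (repr g ++ repr h).
Definition presented_one := of_word [::].
Definition presented_inv (g : presented_group) := of_word (winv (repr g)).

Lemma of_wordM u v : of_word (u ++ v) = presented_mul (of_word u) (of_word v).
Proof.
apply/of_wordP/presentation_cat; apply/of_wordP; exact/esym/of_word_repr.
Qed.

Lemma presentation_mulV w : peq (w ++ winv w) [::].
Proof.
elim: w => [|[x b] w IHw] /=; first exact: presentation_refl.
have -> : (x, b) :: w ++ winv ((x, b) :: w) =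
          [:: (x, b)] ++ ((w ++ winv w) ++ [:: (x, ~~ b)]).
  by rewrite /winv /= rev_cons -cats1 catA.
apply: presentation_trans (presentation_cancel rels x b).
apply: (presentation_cat (presentation_refl _ _)).
exact: (presentation_cat IHw (presentation_refl _ _)).
Qed.

Lemma winvK : involutive (@winv X).
Proof.
move=> w; rewrite /winv map_rev revK -map_comp map_id_in // => -[x b] _ /=.
by rewrite negbK.
Qed.

Fact presented_mulA : associative presented_mul.
Proof.
move=> f g h; rewrite -(of_word_repr f) -(of_word_repr g) -(of_word_repr h).
by rewrite -!of_wordM catA.
Qed.

Fact presented_mul1 : left_id presented_one presented_mul.
Proof. by move=> g; rewrite -(of_word_repr g) -of_wordM. Qed.

Fact presented_mulr1 : right_id presented_one presented_mul.
Proof. by move=> g; rewrite -(of_word_repr g) -of_wordM cats0. Qed.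

Fact presented_mulV : left_inverse presented_one presented_inv presented_mul.
Proof.
move=> g; rewrite -{2}(of_word_repr g) -of_wordM; apply/of_wordP.
by rewrite -{2}(winvK (repr g)); apply: presentation_mulV.
Qed.

Fact presented_mulrV : right_inverse presented_one presented_inv presented_mul.
Proof.
move=> g; rewrite -{1}(of_word_repr g) -of_wordM; apply/of_wordP.
exact: presentation_mulV.
Qed.

HB.instance Definition _ := isGroup.Build presented_group
  presented_mulA presented_mul1 presented_mulr1 presented_mulV presented_mulrV.

End PresentedGroup.

Local Open Scope group_scope.

(* The generator sigma_1 is the letter ord0, sigma_2 is the letter ord_max.   *)
Definition braid_relations : seq (word 'I_2 * word 'I_2) :=
  let a : 'I_2 * bool := (ord0, false) in
  let b : 'I_2 * bool := (ord_max, false) in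
  [:: ([:: a; b; a], [:: b; a; b])].

Definition B3 : groupType := presented_group braid_relations.

Definition sigma1 : B3 := of_word braid_relations [:: (ord0, false)].
Definition sigma2 : B3 := of_word braid_relations [:: (ord_max, false)].

Definition Delta : B3 := sigma1 * sigma2 * sigma1.

Definition positive_half_twist (g : B3) : Prop := exists h : B3, g = sigma1 ^ h.

Definition power_of_half_twist (g : B3) : Prop :=
  exists t : B3, exists e : nat,
    [/\ positive_half_twist t, (1 <= e)%N & g = t ^+ e].

Definition factorization (g : B3) (k : nat) (f : k.-tuple B3) : Prop :=
  g = \prod_(x <- f) x.

(* Main.v *)
Require Import Defs.
From mathcomp Require Import all_boot.
From mathcomp Require Import all_algebra.

(** Artin's braid group [B3] acts on [Z^2] by
    [sigma1 |-> (1 1; 0 1)] and [sigma2 |-> (1 0; -1 1)], and the full twist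
    [Delta ^+ 2] acts as [-1], hence has trace [-2].  Every conjugate of a
    power of [sigma1], with positive, zero or negative exponent, acts by a
    conjugate of a unipotent matrix [(1 n; 0 1)], hence has trace [2]
    ([tr_power_of_half_twist], [tr_power_of_half_twistV]).

    The traces alone forbid fewer than three factors: for zero or one factor,
    [-1] would have trace [2]; for two factors, [g1 = Delta ^+ 2 * g2^-1]
    would have trace [2] on the left and minus the trace of [g2^-1], that is
    [-2], on the right.

    The action is obtained from a general fact, [word_eval_peq]: evaluating
    words in a ring respects the congruence of a presentation as soon as the
    images of the letters cancel and satisfy the relations. *)

Set Implicit Arguments.
Unset Strict Implicit.
Unset Printing Implicit Defensive.

Import GRing.Theory.
Local Open Scope ring_scope.

Section Evaluation.

Variables (X : choiceType) (rels : seq (word X * word X)).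
Variables (R : pzRingType) (rho : X * bool -> R).

Definition word_eval (w : word X) : R := \prod_(a <- w) rho a.

Hypothesis rho_cancel : forall x b, rho (x, b) * rho (x, ~~ b) = 1.
Hypothesis rho_rels : {in rels, forall r, word_eval r.1 = word_eval r.2}.

(** Evaluation is multiplicative, so the words with equal images form a
    congruence; the two hypotheses put the generators of the presentation
    congruence into it. *)
Lemma word_eval_peq u v :
  presentation_eq rels u v -> word_eval u = word_eval v.
Proof.
elim=> {u v} // [u v w _ -> _ -> // | u u' v v' _ Eu _ Ev | x b].
- by rewrite /word_eval !big_cat /= -/(word_eval u) Eu -/(word_eval v) Ev.
- by rewrite /word_eval !big_cons big_nil mulr1 rho_cancel.
Qed.

Definition presented_eval (g : presented_group rels) : R := word_eval (repr g).

Lemma presented_eval_word w : presented_eval (of_word rels w) = word_eval w.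
Proof. by apply/word_eval_peq/of_wordP; apply: of_word_repr. Qed.

Lemma presented_evalM g h :
  presented_eval (g * h)%g = presented_eval g * presented_eval h.
Proof. by rewrite [LHS]presented_eval_word /word_eval big_cat. Qed.

Lemma presented_eval1 : presented_eval 1%g = 1.
Proof. by rewrite [LHS]presented_eval_word /word_eval big_nil. Qed.

End Evaluation.

Section Matrices2.

Variable R : comNzRingType.

Definition mx2 (a b c d : R) : 'M[R]_2 :=
  \matrix_(i, j) if i == 0 then if j == 0 then a else b
                 else if j == 0 then c else d.

Lemma mx2M a b c d a' b' c' d' :
  mx2 a b c d * mx2 a' b' c' d' =
  mx2 (a * a' + b * c') (a * b' + b * d') (c * a' + d * c') (c * b' + d * d').
Proof.
apply/matrixP=> i j; rewrite !mxE !big_ord_recl big_ord0 !mxE /= addr0.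
by case: (i == 0); case: (j == 0).
Qed.

Lemma mx2_scalar a : mx2 a 0 0 a = a%:M.
Proof.
by apply/matrixP=> i j; rewrite !mxE; case: i => [[|[|]]] //= ?;
  case: j => [[|[|]]].
Qed.

Lemma tr_mx2 a b c d : \tr (mx2 a b c d) = a + d.
Proof. by rewrite /mxtrace !big_ord_recl big_ord0 !mxE /= addr0. Qed.

End Matrices2.

(** The reduced Burau representation at [t = -1]. *)
Definition burau (a : 'I_2 * bool) : 'M[int]_2 :=
  let n : int := if a.2 then -1 else 1 in
  if a.1 == ord0 then mx2 1 n 0 1 else mx2 1 0 (- n) 1.

Lemma burau_cancel x b : burau (x, b) * burau (x, ~~ b) = 1.
Proof.
rewrite /burau /=; case: (x == ord0); case: b;
  by rewrite mx2M -[1 in RHS]mx2_scalar.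
Qed.

Lemma burau_braid :
  {in braid_relations, forall r, word_eval burau r.1 = word_eval burau r.2}.
Proof.
by move=> r; rewrite inE => /eqP->; rewrite /word_eval !big_cons !big_nil
  /burau /= !mulr1 !mx2M.
Qed.

Definition B3_mx (g : B3) : 'M[int]_2 := presented_eval burau g.

Lemma B3_mxM g h : B3_mx (g * h)%g = B3_mx g * B3_mx h.
Proof. exact: (presented_evalM burau_cancel burau_braid). Qed.

Lemma B3_mx1 : B3_mx 1%g = 1.
Proof. exact: (presented_eval1 burau_cancel burau_braid). Qed.

Lemma B3_mx_gen (i : 'I_2) b :
  B3_mx (of_word braid_relations [:: (i, b)]) = burau (i, b).
Proof.
rewrite [LHS](presented_eval_word burau_cancel burau_braid).
by rewrite /word_eval big_seq1.
Qed.

Lemma B3_mx_full_twist : B3_mx (Delta ^+ 2)%g = -1.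
Proof.
rewrite expgS expg1 /Delta !B3_mxM !B3_mx_gen /burau /= !mx2M.
have -> : -1 = (-1)%:M :> 'M[int]_2 by rewrite raddfN.
exact: mx2_scalar.
Qed.

Lemma tr_B3_mxJ g h : \tr (B3_mx (g ^ h)%g) = \tr (B3_mx g).
Proof.
rewrite /conjg !B3_mxM [LHS]mxtrace_mulC -mulmxA.
by rewrite -[_ *m B3_mx _^-1%g]/(_ * _) -B3_mxM mulgV B3_mx1 mulmx1.
Qed.

(** Powers of a unipotent stay unipotent. Taking [n = 1] and [n = -1] covers
    the powers of [sigma1] and those of its inverse. *)
Lemma B3_mx_unipotentX (g : B3) n e :
  B3_mx g = mx2 1 n 0 1 -> B3_mx (g ^+ e)%g = mx2 1 (n *+ e) 0 1.
Proof.
move=> gE; elim: e => [|e IHe]; first by rewrite expg0 B3_mx1 -[1]mx2_scalar.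
rewrite expgS B3_mxM gE IHe mx2M !mul0r !mulr0 !mul1r !mulr1 !addr0 add0r.
by rewrite mulrS addrC.
Qed.

Lemma tr_power_of_half_twist g :
  power_of_half_twist g -> \tr (B3_mx g) = 2.
Proof.
case=> _ [e [[h ->] _ ->]]; rewrite -conjXg tr_B3_mxJ.
by rewrite (@B3_mx_unipotentX _ 1) ?tr_mx2 // B3_mx_gen.
Qed.

Lemma tr_power_of_half_twistV g :
  power_of_half_twist g -> \tr (B3_mx g^-1%g) = 2.
Proof.
case=> _ [e [[h ->] _ ->]]; rewrite -conjXg -conjVg tr_B3_mxJ -expVgn.
rewrite (@B3_mx_unipotentX _ (-1)) ?tr_mx2 //.
suff -> : (sigma1^-1)%g = of_word braid_relations [:: (ord0, true)].
  by rewrite B3_mx_gen.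
apply/(mulgI sigma1); rewrite mulgV; apply/esym.
rewrite -[LHS]of_wordM; apply/of_wordP; exact: presentation_cancel.
Qed.

(** The full twist acts as a scalar, so multiplying by it flips the sign of
    every trace; this is incompatible with powers of half-twists and their
    inverses all having the same nonzero trace. *)
Lemma tr_full_twistM g : \tr (B3_mx (Delta ^+ 2 * g)%g) = - \tr (B3_mx g).
Proof. by rewrite B3_mxM B3_mx_full_twist mulN1r raddfN. Qed.

Local Close Scope ring_scope.
Local Open Scope group_scope.

Theorem lemma4p53 (k : nat) (f : k.-tuple B3) :
  factorization (Delta ^+ 2) f ->
  (forall i : 'I_k, power_of_half_twist (tnth f i)) ->
  (3 <= k)%N.
Proof.
move=> fP fH.
have fHT g : g \in tval f -> power_of_half_twist g by case/tnthP=> i ->.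
have trD : (\tr (B3_mx (Delta ^+ 2)%g) = -2)%R.
  by rewrite -[Delta ^+ 2]mulg1 tr_full_twistM B3_mx1 mxtrace1.
have {fP} fP : Delta ^+ 2 = \prod_(x <- f) x := fP.
rewrite -(size_tuple f).
case: (tval f) fP fHT => [|g1 [|g2 [|g3 s]]] //= fP fHT; exfalso.
- by move: trD; rewrite fP big_nil B3_mx1 mxtrace1.
- move: trD; rewrite fP big_seq1 tr_power_of_half_twist //.
  by apply: fHT; rewrite mem_head.
(* Moving [g2] to the other side avoids computing the trace of a product of
   two unrelated conjugates. *)
have g1E : g1 = Delta ^+ 2 * g2^-1 by rewrite fP big_cons big_seq1 mulgK.
have: (\tr (B3_mx g1) = 2)%R.
  by apply/tr_power_of_half_twist/fHT; rewrite mem_head.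
rewrite g1E tr_full_twistM tr_power_of_half_twistV //.
by apply: fHT; rewrite !inE eqxx orbT.
Qed.
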